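(* Let $F$ be a non-trivial (i.e. $k\notin\{1,n-1\}$) $(n,k)$-frame. Then $F$ is $4_c$-uniform if and only if its Seidel matrix is switching equivalent to $$\begin{bmatrix}0&1&1&1\\1&0&-i&i\\1&i&0&-i\\1&-i&i&0\end{bmatrix}.$$
   Context: An $(n,k)$-frame is a Parseval frame $\{f_i\}_{i=1}^n$ for $\mathbb{F}^k$, $\mathbb{F}\in\{\mathbb{R},\mathbb{C}\}$, with analysis operator $V$, $Vx=(\langle x,f_i\rangle)_{i=1}^n$. Let $\mathcal{D}_m$ be the set of $n\times n$ diagonal matrices with exactly $m$ diagonal entries equal to $1$ and the rest $0$. $F$ is $m$-uniform if $\|V^*DV\|$ (operator norm) is the same for all $D\in\mathcal{D}_m$, and $m_c$-uniform if it is $\ell$-uniform for all $\ell=1,\dots,m$. A $2_c$-uniform frame is an equiangular Parseval frame and its Seidel matrix $Q$ is defined by $VV^*=\frac{k}{n}I+c_{n,k}Q$ with $c_{n,k}=\sqrt{\frac{k(n-k)}{n^2(n-1)}}$. Two Seidel matrices $Q,S$ are switching equivalent if $Q=PDSD^{-1}P^{-1}$ with $P$ a permutation matrix and $D$ diagonal with unimodular diagonal entries. *)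

(* Defs.v *)
From HB Require Import structures.
From mathcomp Require Import all_boot all_order all_fingroup all_algebra.
From mathcomp Require Import complex.
From mathcomp Require Import boolp classical_sets reals.
Set Implicit Arguments. Unset Strict Implicit. Unset Printing Implicit Defensive.
Import Order.TTheory GRing.Theory Num.Theory.
Local Open Scope ring_scope.

(* The scalar field F: realF = true means F = R (embedded in R[i]), realF = false means F = C. *)
Definition inF (R : rcfType) (realF : bool) (z : R[i]) : bool :=
  realF ==> (complex.Im z == 0).
Definition inFvec (R : rcfType) (realF : bool) k (x : 'cV[R[i]]_k) : bool :=
  [forall j, inF realF (x j 0)].

Definition abs2 (R : rcfType) (z : R[i]) : R := complex.Re z ^+ 2 + complex.Im z ^+ 2.
Definition cvnorm (R : rcfType) k (x : 'cV[R[i]]_k) : R :=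
  Num.sqrt (\sum_j abs2 (x j 0)).
Definition cinner (R : rcfType) k (x y : 'cV[R[i]]_k) : R[i] :=
  \sum_j x j 0 * conjc (y j 0).
Definition adjmx (R : rcfType) m n (A : 'M[R[i]]_(m, n)) : 'M[R[i]]_(n, m) :=
  \matrix_(i, j) conjc (A j i).

(* analysis operator V : V x = (<x, f_i>)_i *)
Definition analysis_op (R : rcfType) n k (f : 'I_n -> 'cV[R[i]]_k) : 'M[R[i]]_(n, k) :=
  \matrix_(i, j) conjc (f i j 0).

Definition parseval_frame (R : rcfType) (realF : bool) n k (f : 'I_n -> 'cV[R[i]]_k) : Prop :=
  (forall i, inFvec realF (f i)) /\
  (forall x : 'cV[R[i]]_k, inFvec realF x ->
     \sum_i abs2 (cinner x (f i)) = \sum_j abs2 (x j 0)).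

Definition opnorm (R : realType) (realF : bool) m k (A : 'M[R[i]]_(m, k)) : R :=
  sup [set cvnorm (A *m x) | x in [set x : 'cV[R[i]]_k | inFvec realF x /\ cvnorm x = 1]].

Definition diag01 (R : rcfType) n (A : {set 'I_n}) : 'M[R[i]]_n :=
  diag_mx (\row_i (if i \in A then 1 else 0)).
Arguments diag01 {R n} A.

Definition uniform (R : realType) (realF : bool) n k (f : 'I_n -> 'cV[R[i]]_k) (m : nat) : Prop :=
  forall A B : {set 'I_n}, #|A| = m -> #|B| = m ->
    opnorm realF (adjmx (analysis_op f) *m diag01 A *m analysis_op f)
    = opnorm realF (adjmx (analysis_op f) *m diag01 B *m analysis_op f).

Definition uniform_c (R : realType) (realF : bool) n k (f : 'I_n -> 'cV[R[i]]_k) (m : nat) : Prop :=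
  forall l : nat, (1 <= l <= m)%N -> uniform realF f l.

Definition cnk (R : rcfType) (n k : nat) : R :=
  Num.sqrt ((k * (n - k))%:R / ((n ^ 2)%:R * (n%:R - 1))).

(* Seidel matrix: V V^* = k/n I + c_{n,k} Q *)
Definition seidel (R : rcfType) n k (f : 'I_n -> 'cV[R[i]]_k) : 'M[R[i]]_n :=
  ((cnk R n k)%:C)%C^-1 *:
    (analysis_op f *m adjmx (analysis_op f) - (k%:R / n%:R : R[i])%:M).

Definition switching_equiv4 (R : rcfType) n (Q : 'M[R[i]]_n) (S : 'M[R[i]]_4) : Prop :=
  exists h : n = 4%N, exists (s : 'S_4) (d : 'rV[R[i]]_4),
    (forall i, abs2 (d 0 i) = 1) /\
    castmx (h, h) Q =
      perm_mx s *m diag_mx d *m S *m invmx (diag_mx d) *m invmx (perm_mx s).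

Local Open Scope complex_scope.
Definition S4rows (R : rcfType) : seq (seq R[i]) :=
  [:: [:: 0; 1; 1; 1];
      [:: 1; 0; - 'i; 'i];
      [:: 1; 'i; 0; - 'i];
      [:: 1; - 'i; 'i; 0]].
Definition S4 (R : rcfType) : 'M[R[i]]_4 :=
  \matrix_(i, j) nth 0 (nth [::] (S4rows R) i) j.

(* Main.v *)
Require Import Defs.
From mathcomp Require Import all_boot all_order all_fingroup all_algebra.
From mathcomp Require Import complex ring lra.
From mathcomp Require Import boolp classical_sets reals.
Set Implicit Arguments. Unset Strict Implicit. Unset Printing Implicit Defensive.
Import Order.TTheory GRing.Theory Num.Theory.
Local Open Scope ring_scope.

(** Let [G] be the Gram matrix of the frame, an orthogonal projection.  The
    norm attached to a set [A] is the largest eigenvalue of the principal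
    submatrix [G_A], hence a root of its characteristic polynomial.  Uniformity
    for 1, 2, 3 and 4 erasures therefore successively forces constancy of the
    diagonal of [G], of [|Q_ab|], of the real part [t] of the triple products
    [T_abc = Q_ab Q_bc Q_ca], and of [det Q_A] for [|A| = 4].  Writing
    [E_abc = Im T_abc], the last one says that
    [E_abc E_acd + E_acd E_adb + E_adb E_abc] is constant.

    Fix [a] and orient [b -> c] when [E_abc > 0].  [G^2 = G] makes every
    vertex of this tournament balanced, so it is not transitive; by constancy
    every triangle is then cyclic, and balance leaves only [n = 4].  The cocycle
    relation [T_bcd = T_abc T_acd T_adb] gives [t = 0], so that all the [T_0bc]
    are [i] or [-i], which determines [Q] up to switching. *)

(** * Adjoints, squared norms and quadratic forms over the complex numbers *)

Section ComplexVectors.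
Local Open Scope complex_scope.
Variable R : rcfType.
Implicit Types z w : R[i].

Lemma mul_conjc z : z * conjc z = (abs2 z)%:C.
Proof. by rewrite -sqr_normc -add_Re2_Im2. Qed.

Lemma conjc_conjC z : conjc z = Num.conj z.
Proof.
have [->|z0] := eqVneq z 0; first by rewrite !rmorph0.
by apply: (mulfI z0); rewrite -sqr_normc normCK.
Qed.

Lemma abs2_ge0 z : 0 <= abs2 z.
Proof. by rewrite addr_ge0 ?sqr_ge0. Qed.

Lemma abs2_eq0 z : (abs2 z == 0) = (z == 0).
Proof.
by rewrite -(inj_eq (@complexI R)) -mul_conjc mulf_eq0 conjc_eq0 orbb.
Qed.

Lemma abs2M z w : abs2 (z * w) = abs2 z * abs2 w.
Proof. by case: z w => [a b] [c d]; rewrite /abs2 /=; ring. Qed.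

Lemma abs2_real (a : R) : abs2 a%:C = a ^+ 2.
Proof. by rewrite /abs2 /= expr0n addr0. Qed.

Lemma Re_sum (I : Type) (r : seq I) (P : pred I) (F : I -> R[i]) :
  complex.Re (\sum_(i <- r | P i) F i) = \sum_(i <- r | P i) complex.Re (F i).
Proof.
by apply: (big_morph (@complex.Re R)) => [[a b] [c d]|].
Qed.

Lemma Im_sum (I : Type) (r : seq I) (P : pred I) (F : I -> R[i]) :
  complex.Im (\sum_(i <- r | P i) F i) = \sum_(i <- r | P i) complex.Im (F i).
Proof.
by apply: (big_morph (@complex.Im R)) => [[a b] [c d]|].
Qed.

Lemma adjmxE m n (A : 'M[R[i]]_(m, n)) : adjmx A = map_mx Num.conj (A^T).
Proof. by apply/matrixP => i j; rewrite !mxE conjc_conjC. Qed.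

Lemma adjmxK m n (A : 'M[R[i]]_(m, n)) : adjmx (adjmx A) = A.
Proof. by apply/matrixP => i j; rewrite !mxE conjcK. Qed.

Lemma adjmxM m n p (A : 'M[R[i]]_(m, n)) (B : 'M[R[i]]_(n, p)) :
  adjmx (A *m B) = adjmx B *m adjmx A.
Proof. by rewrite !adjmxE trmx_mul map_mxM. Qed.

Lemma adjmx_diag01 n (A : {set 'I_n}) : adjmx (diag01 A) = diag01 A :> 'M[R[i]]_n.
Proof.
apply/matrixP => i j; rewrite !mxE eq_sym.
by case: eqVneq => [->|_]; case: ifP; rewrite ?mulr1n ?mulr0n ?conjc1 ?conjc0.
Qed.

Definition sqnorm k (x : 'cV[R[i]]_k) : R := \sum_j abs2 (x j 0).

Lemma sqnorm_ge0 k (x : 'cV[R[i]]_k) : 0 <= sqnorm x.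
Proof. by apply: sumr_ge0 => j _; apply: abs2_ge0. Qed.

Lemma adjmx_mul_self k (x : 'cV[R[i]]_k) : (adjmx x *m x) 0 0 = (sqnorm x)%:C.
Proof.
by rewrite !mxE rmorph_sum; apply: eq_bigr => j _; rewrite mxE mulrC mul_conjc.
Qed.

Lemma sqnorm_eq0 k (x : 'cV[R[i]]_k) : (sqnorm x == 0) = (x == 0).
Proof.
apply/eqP/eqP => [/eqP|->]; last first.
  by rewrite /sqnorm big1 // => j _; rewrite mxE; apply/eqP; rewrite abs2_eq0.
rewrite psumr_eq0 => [/allP x0|j _]; last exact: abs2_ge0.
apply/colP => j; rewrite mxE; apply/eqP.
by rewrite -abs2_eq0; apply: x0; rewrite mem_index_enum.
Qed.

Lemma sqnormZ k (a : R[i]) (x : 'cV[R[i]]_k) :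
  sqnorm (a *: x) = abs2 a * sqnorm x.
Proof. by rewrite mulr_sumr; apply: eq_bigr => j _; rewrite mxE abs2M. Qed.

Lemma sqnorm_isometry n k (U : 'M[R[i]]_(n, k)) (x : 'cV[R[i]]_k) :
  adjmx U *m U = 1%:M -> sqnorm (U *m x) = sqnorm x.
Proof.
move=> UU; apply: (@complexI R); rewrite -!adjmx_mul_self adjmxM.
by rewrite -mulmxA [adjmx U *m _]mulmxA UU mul1mx.
Qed.

(** The parts are kept as complex vectors with real entries, so that complex matrices act on them
    and [inFvec true] applies. *)
Definition Repart k (x : 'cV[R[i]]_k) : 'cV[R[i]]_k :=
  \col_j (complex.Re (x j 0))%:C.
Definition Impart k (x : 'cV[R[i]]_k) : 'cV[R[i]]_k :=
  \col_j (complex.Im (x j 0))%:C.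

Lemma Repart_real k (x : 'cV[R[i]]_k) : inFvec true (Repart x).
Proof. by apply/forallP => j; rewrite mxE /inF /= eqxx. Qed.

Lemma Impart_real k (x : 'cV[R[i]]_k) : inFvec true (Impart x).
Proof. by apply/forallP => j; rewrite mxE /inF /= eqxx. Qed.

Lemma Repart_mulmx n k (A : 'M[R[i]]_(n, k)) (x : 'cV[R[i]]_k) :
  (forall i j, inF true (A i j)) -> Repart (A *m x) = A *m Repart x.
Proof.
move=> Ar; apply/colP => i; rewrite !mxE Re_sum rmorph_sum.
apply: eq_bigr => j _; rewrite mxE; have /eqP /= := Ar i j.
by case: (A i j) (x j 0) => [a b] [c d] /= ->; simpc.
Qed.

Lemma Impart_mulmx n k (A : 'M[R[i]]_(n, k)) (x : 'cV[R[i]]_k) :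
  (forall i j, inF true (A i j)) -> Impart (A *m x) = A *m Impart x.
Proof.
move=> Ar; apply/colP => i; rewrite !mxE Im_sum rmorph_sum.
apply: eq_bigr => j _; rewrite mxE; have /eqP /= := Ar i j.
by case: (A i j) (x j 0) => [a b] [c d] /= ->; simpc.
Qed.

Lemma sqnorm_parts k (x : 'cV[R[i]]_k) :
  sqnorm x = sqnorm (Repart x) + sqnorm (Impart x).
Proof.
by rewrite -big_split; apply: eq_bigr => j _; rewrite !mxE !abs2_real.
Qed.

(* Polarization. *)
Lemma quadratic_form_eq0 k (K : 'M[R[i]]_k) :
  (forall x : 'cV[R[i]]_k, (adjmx x *m K *m x) 0 0 = 0) -> K = 0.
Proof.
move=> K0.
have E a b z : K a a + z * K a b + conjc z * K b a + z * conjc z * K b b = 0.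
  rewrite -(K0 (delta_mx a 0 + z *: delta_mx b 0)).
  have -> : adjmx (delta_mx a 0 + z *: delta_mx b 0) =
            delta_mx 0 a + conjc z *: delta_mx 0 b :> 'rV[R[i]]_k.
    apply/rowP => j; rewrite !mxE rmorphD rmorphM /=.
    by rewrite !eqxx !andbT /= !conjc_nat.
  have ent c d : (delta_mx 0 c *m K *m delta_mx d 0 : 'M_1) 0 0 = K c d.
    by rewrite -rowE -colE !mxE.
  have rD (A B : 'M[R[i]]_1) : (A + B) 0 0 = A 0 0 + B 0 0 by rewrite mxE.
  have rZ c (A : 'M[R[i]]_1) : (c *: A) 0 0 = c * A 0 0 by rewrite mxE.
  rewrite !mulmxDl !mulmxDr -!scalemxAl -!scalemxAr !(rD, rZ) !ent.
  by ring.
have Kd a : K a a = 0.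
  by have := E a a 0; rewrite conjc0 !(mul0r, addr0).
apply/matrixP => a b; rewrite mxE.
have := E a b 1; have := E a b 'i%C; rewrite !Kd conjc1.
have -> : conjc 'i%C = - 'i%C :> R[i] by simpc.
have i2 : 'i%C * 'i%C = -1 :> R[i] by rewrite -expr2 sqr_i.
set u := K a b; set v := K b a => Ei E1.
have Ei' : - u + v = 0.
  rewrite -[RHS](mulr0 'i%C) -Ei.
  rewrite !(add0r, mulr0, addr0) mulrDr mulNr mulrN !mulrA i2; ring.
have E1' : u + v = 0 by rewrite -E1; ring.
have : u + v - (- u + v) = 0 by rewrite Ei' E1' subr0.
have -> : u + v - (- u + v) = u *+ 2 by ring.
by move/eqP; rewrite mulrn_eq0 /= => /eqP.
Qed.

End ComplexVectors.

(** * Operator norms of positive semidefinite matrices *)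

Section OperatorNorm.
Local Open Scope complex_scope.
Variable R : realType.
Variable realF : bool.

Lemma sup_attained (E : set R) (l : R) : E l -> ubound E l -> sup E = l.
Proof.
move=> El ubl; apply/le_anti/andP; split; first by apply: ge_sup; first by exists l.
by apply: ub_le_sup => //; exists l.
Qed.

(** Over the reals [opnorm] only tests real vectors, while diagonalization yields complex ones. A
    real matrix with a real eigenvalue acts separately on real and imaginary parts, and one of these
    is nonzero. *)
Lemma real_eigenvector k (H : 'M[R[i]]_k) (l : R) (x : 'cV[R[i]]_k) :
  (forall i j, inF realF (H i j)) -> x != 0 -> H *m x = l%:C *: x ->
  exists y : 'cV[R[i]]_k, [/\ inFvec realF y, y != 0 & H *m y = l%:C *: y].
Proof.
case: realF => [Hr x0 Hx|_ x0 Hx]; last by exists x; split => //; apply/forallP.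
have ReZ : Repart (l%:C *: x) = l%:C *: Repart x.
  by apply/colP => j; rewrite !mxE; case: (x j 0) => a b; simpc.
have ImZ : Impart (l%:C *: x) = l%:C *: Impart x.
  by apply/colP => j; rewrite !mxE; case: (x j 0) => a b; simpc.
have [Re0|Re_neq0] := eqVneq (Repart x) 0; last first.
  by exists (Repart x); rewrite Repart_real -Repart_mulmx // Hx ReZ.
exists (Impart x); rewrite Impart_real -Impart_mulmx // Hx ImZ; split => //.
rewrite -sqnorm_eq0; move: x0; rewrite -sqnorm_eq0 sqnorm_parts Re0.
suff -> : sqnorm (0 : 'cV[R[i]]_k) = 0 by rewrite add0r.
by apply/eqP; rewrite sqnorm_eq0.
Qed.

Lemma hermitian_spectral k (H : 'M[R[i]]_k) : adjmx H = H ->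
  exists (P : 'M[R[i]]_k) (r : 'I_k -> R),
    [/\ adjmx P *m P = 1%:M, P *m adjmx P = 1%:M &
        H = adjmx P *m diag_mx (\row_i (r i)%:C) *m P].
Proof.
move=> HH; have Hh : H \is hermsymmx.
  by apply/is_hermitianmxP; rewrite expr0 scale1r -adjmxE HH.
have PU := spectral_unitarymx H.
exists (spectralmx H), (fun i => complex.Re (spectral_diag H 0 i)).
have P1 : spectralmx H *m adjmx (spectralmx H) = 1%:M.
  by rewrite adjmxE; apply/unitarymxP.
split => //; first exact: mulmx1C.
have /orthomx_spectralP E := hermitian_normalmx Hh.
have -> : \row_i (complex.Re (spectral_diag H 0 i))%:C = spectral_diag H.
  apply/rowP => i; rewrite mxE RRe_real //.
  by have /mxOverP := hermitian_spectral_diag_real Hh; apply.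
rewrite adjmxE -(invmx_unitary PU); exact: E.
Qed.

(** In a unitary eigenbasis the norm is the largest eigenvalue [r m], which is attained and bounds
    the Rayleigh quotient. By [real_eigenvector] this is so for either scalar field. *)
Lemma opnorm_psd k (H : 'M[R[i]]_k) : (0 < k)%N -> adjmx H = H ->
  (forall i j, inF realF (H i j)) ->
  (forall x : 'cV[R[i]]_k, 0 <= complex.Re ((adjmx x *m H *m x) 0 0)) ->
  (exists2 x : 'cV[R[i]]_k, x != 0 & H *m x = (opnorm realF H)%:C *: x) /\
  (forall x : 'cV[R[i]]_k,
     complex.Re ((adjmx x *m H *m x) 0 0) <= opnorm realF H * sqnorm x).
Proof.
move=> k0 HH HF Hpsd; have [P [r [PP PP' HE]]] := hermitian_spectral HH.
have HmulE (x : 'cV[R[i]]_k) :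
    H *m x = adjmx P *m (diag_mx (\row_i (r i)%:C) *m (P *m x)).
  by rewrite [in LHS]HE !mulmxA.
have formE (x : 'cV[R[i]]_k) : complex.Re ((adjmx x *m H *m x) 0 0) =
    \sum_i r i * abs2 ((P *m x) i 0).
  have -> : adjmx x *m H *m x =
     adjmx (P *m x) *m (diag_mx (\row_i (r i)%:C) *m (P *m x)).
    by rewrite -(mulmxA _ H x) HmulE adjmxM -[RHS]mulmxA.
  rewrite mxE Re_sum; apply: eq_bigr => i _; rewrite mul_diag_mx !mxE.
  by set z := \sum__ _; case: z => a b; rewrite /abs2 /=; ring.
pose v i : 'cV[R[i]]_k := adjmx P *m delta_mx i 0.
have eigP i : H *m v i = (r i)%:C *: v i.
  have de : diag_mx (\row_i (r i)%:C) *m delta_mx i 0 =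
      (r i)%:C *: delta_mx i 0 :> 'cV[R[i]]_k.
    apply/colP => j; rewrite mul_diag_mx !mxE.
    by case: eqVneq => [->|]; rewrite ?mulr0.
  by rewrite HmulE /v [P *m (_ *m _)]mulmxA PP' mul1mx de scalemxAr.
have sqP i : sqnorm (v i) = 1.
  rewrite /v sqnorm_isometry ?adjmxK // /sqnorm (bigD1 i) //= big1 => [|j ji].
    by rewrite !mxE !eqxx -[1%:R]/(1%:C) abs2_real expr1n addr0.
  by rewrite mxE (negPf ji) /=; apply/eqP; rewrite abs2_eq0.
have r_ge0 i : 0 <= r i.
  have := Hpsd (v i); rewrite -mulmxA eigP -scalemxAr mxE.
  by rewrite adjmx_mul_self sqP /= mulr1 mul0r subr0.
pose i0 : 'I_k := Ordinal k0.
pose m := [arg max_(i > i0) r i]%O.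
have rm i : r i <= r m by rewrite /m; case: Order.TotalTheory.arg_maxP => // j _; apply.
have sqH x : sqnorm (H *m x) <= r m ^+ 2 * sqnorm x.
  rewrite HmulE sqnorm_isometry ?adjmxK //.
  rewrite -[in leRHS](sqnorm_isometry x PP) mulr_sumr; apply: ler_sum => i _.
  rewrite mul_diag_mx !mxE abs2M abs2_real ler_wpM2r ?abs2_ge0 //.
  by rewrite ler_sqr ?nnegrE.
have x0 : v m != 0.
  by rewrite -sqnorm_eq0 sqP oner_eq0.
have opE : opnorm realF H = r m.
  have [y [yF y0 Hy]] := real_eigenvector HF x0 (eigP m).
  have sy : 0 < sqnorm y by rewrite lt_def sqnorm_eq0 y0 sqnorm_ge0.
  apply: sup_attained => /=.
    pose c := (Num.sqrt (sqnorm y))^-1; exists (c%:C *: y).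
      split; last first.
        rewrite /cvnorm -/(sqnorm _) sqnormZ abs2_real exprVn sqr_sqrtr ?ltW //.
        by rewrite mulVf ?gt_eqF // sqrtr1.
      apply/forallP => j; have /forallP /(_ j) := yF; rewrite mxE /inF.
      by case: realF => //=; case: (y j 0) => a b /= /eqP ->; rewrite mulr0 mul0r addr0.
    rewrite /cvnorm -/(sqnorm _) -scalemxAr Hy scalerA -rmorphM sqnormZ abs2_real.
    rewrite exprMn exprVn sqr_sqrtr ?ltW // mulrAC mulVf ?gt_eqF // mul1r.
    by rewrite sqrtr_sqr ger0_norm.
  move=> _ [x [_ x1] <-]; rewrite /cvnorm -/(sqnorm _).
  rewrite -[leRHS]ger0_norm // -sqrtr_sqr ler_wsqrtr // (le_trans (sqH x)) //.
  have -> : sqnorm x = 1; last by rewrite mulr1.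
  by rewrite -[LHS]sqr_sqrtr ?sqnorm_ge0 // -/(sqnorm _) [Num.sqrt _]x1 expr1n.
rewrite opE; split; first by exists (v m).
move=> x; rewrite formE -(sqnorm_isometry x PP) mulr_sumr.
by apply: ler_sum => i _; rewrite ler_wpM2r ?abs2_ge0.
Qed.

End OperatorNorm.

(** * Gram matrices of Parseval frames and the norms of their compressions *)

Section Frames.
Local Open Scope complex_scope.
Variable R : realType.
Variable realF : bool.

Lemma inF_mulmx m n p (A : 'M[R[i]]_(m, n)) (B : 'M[R[i]]_(n, p)) :
  (forall i j, inF realF (A i j)) -> (forall i j, inF realF (B i j)) ->
  forall i j, inF realF ((A *m B) i j).
Proof.
rewrite /inF; case: realF => //= Ar Br i j; rewrite mxE Im_sum big1 // => l _.
have /eqP := Ar i l; have /eqP := Br l j.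
by case: (A i l) (B l j) => [a b] [c d] /= -> ->; rewrite mulr0 mul0r addr0.
Qed.

Lemma inF_adjmx m n (A : 'M[R[i]]_(m, n)) :
  (forall i j, inF realF (A i j)) -> forall i j, inF realF (adjmx A i j).
Proof.
rewrite /inF; case: realF => //= Ar i j; rewrite mxE.
by have /eqP := Ar j i; case: (A j i) => a b /= ->; rewrite oppr0.
Qed.

Lemma inF_diag01 n (A : {set 'I_n}) i j : inF realF ((diag01 A : 'M[R[i]]_n) i j).
Proof.
rewrite /inF !mxE; case: realF => //=.
by case: (i == j); case: (i \in A); rewrite ?mulr1n ?mulr0n.
Qed.

Lemma diag01_mul n (A : {set 'I_n}) (x : 'cV[R[i]]_n) i :
  (diag01 A *m x) i 0 = if i \in A then x i 0 else 0.
Proof. by rewrite mul_diag_mx !mxE; case: ifP; rewrite ?mul1r ?mul0r. Qed.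

Lemma diag01_id n (A : {set 'I_n}) (x : 'cV[R[i]]_n) :
  (forall i, i \notin A -> x i 0 = 0) -> diag01 A *m x = x.
Proof.
move=> xA; apply/colP => i; rewrite diag01_mul.
by case: ifP => // /negbT /xA ->.
Qed.

Lemma diag01_idem n (A : {set 'I_n}) (x : 'cV[R[i]]_n) :
  diag01 A *m (diag01 A *m x) = diag01 A *m x.
Proof. by apply: diag01_id => i iA; rewrite diag01_mul (negPf iA). Qed.

Definition gram n k (f : 'I_n -> 'cV[R[i]]_k) : 'M[R[i]]_n :=
  analysis_op f *m adjmx (analysis_op f).

Definition comp_norm n k (f : 'I_n -> 'cV[R[i]]_k) (A : {set 'I_n}) : R :=
  opnorm realF (adjmx (analysis_op f) *m diag01 A *m analysis_op f).

Variables (n k : nat) (f : 'I_n -> 'cV[R[i]]_k).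
Hypothesis f_parseval : parseval_frame realF f.
Local Notation V := (analysis_op f).
Local Notation G := (gram f).

Lemma analysis_op_inF i j : inF realF (V i j).
Proof.
have [/(_ i)/forallP/(_ j) fF _] := f_parseval.
move: fF; rewrite /inF; case: realF => //=; rewrite mxE.
by case: (f i j 0) => a b /= /eqP ->; rewrite oppr0.
Qed.

(** Over the reals the Parseval identity is given for real vectors only; as [V] is then real, it
    extends to complex ones through their real and imaginary parts. *)
Lemma parseval_isometry (x : 'cV[R[i]]_k) : sqnorm (V *m x) = sqnorm x.
Proof.
have VE (y : 'cV[R[i]]_k) : inFvec realF y -> sqnorm (V *m y) = sqnorm y.
  move=> yF; have [_ /(_ y yF) yE] := f_parseval; rewrite /sqnorm -yE.
  apply: eq_bigr => i _; congr abs2; rewrite mxE; apply: eq_bigr => j _.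
  by rewrite mxE mulrC.
have VF := analysis_op_inF.
case: realF VE VF => VE VF; last by apply: VE; apply/forallP.
rewrite sqnorm_parts Repart_mulmx // Impart_mulmx // !VE ?Repart_real ?Impart_real //.
by rewrite -sqnorm_parts.
Qed.

Lemma parseval_adj : adjmx V *m V = 1%:M.
Proof.
apply: subr0_eq; apply: (@quadratic_form_eq0 R k _) => x.
rewrite mulmxBr mulmx1 mulmxBl.
have -> : adjmx x *m (adjmx V *m V) *m x = adjmx (V *m x) *m (V *m x).
  by rewrite adjmxM !mulmxA.
have rB (A B : 'M[R[i]]_1) : (A - B) 0 0 = A 0 0 - B 0 0 by rewrite !mxE.
by rewrite rB !adjmx_mul_self parseval_isometry subrr.
Qed.

Lemma gram_adj : adjmx G = G.
Proof. by rewrite adjmxM adjmxK. Qed.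

Lemma gram_conj i j : conjc (G i j) = G j i.
Proof. by rewrite -{2}gram_adj [RHS]mxE. Qed.

Lemma gram_idem : G *m G = G.
Proof. by rewrite mulmxA -(mulmxA V) parseval_adj mulmx1. Qed.

Lemma gram_trace : \tr G = k%:R.
Proof. by rewrite mxtrace_mulC parseval_adj mxtrace1. Qed.

Hypothesis k_gt0 : (0 < k)%N.

Lemma comp_norm_psd A :
  (exists2 x : 'cV[R[i]]_k, x != 0 &
     adjmx V *m diag01 A *m V *m x = (comp_norm f A)%:C *: x) /\
  (forall x : 'cV[R[i]]_k,
     sqnorm (diag01 A *m (V *m x)) <= comp_norm f A * sqnorm x).
Proof.
have formE (x : 'cV[R[i]]_k) :
    adjmx x *m (adjmx V *m diag01 A *m V) *m x =
    adjmx (diag01 A *m (V *m x)) *m (diag01 A *m (V *m x)).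
  by rewrite 2!adjmxM adjmx_diag01 -[in RHS]mulmxA diag01_idem !mulmxA.
have [||||H1 H2] := @opnorm_psd R realF _ (adjmx V *m diag01 A *m V).
- exact: k_gt0.
- by rewrite !adjmxM adjmxK adjmx_diag01 mulmxA.
- by do !apply: inF_mulmx => //; do ?[exact: inF_diag01
    | exact: inF_adjmx analysis_op_inF | exact: analysis_op_inF].
- by move=> x; rewrite formE adjmx_mul_self sqnorm_ge0.
split => // x; have := H2 x; rewrite formE adjmx_mul_self /=; exact.
Qed.

(** [X Y] and [Y X] share their nonzero eigenvalues: an eigenvector [x] of the compression is
    carried to [diag01 A *m (V *m x)], an eigenvector of the principal submatrix of [G] on [A].
    Positivity of the eigenvalue keeps the image nonzero. *)
Lemma comp_norm_eigen (A : {set 'I_n}) : 0 < comp_norm f A ->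
  exists y : 'cV[R[i]]_n, [/\ y != 0, forall i, i \notin A -> y i 0 = 0 &
    forall i, i \in A -> (G *m y) i 0 = (comp_norm f A)%:C * y i 0].
Proof.
move=> l0; have [[x x0 xE] _] := comp_norm_psd A.
pose y := diag01 A *m (V *m x).
have yE : adjmx V *m y = (comp_norm f A)%:C *: x by rewrite -xE !mulmxA.
exists y; split.
- apply: contra_neq x0 => y0; move: yE; rewrite y0 mulmx0 => /esym/eqP.
  rewrite scaler_eq0 -[0]/(0%:C) (inj_eq (@complexI R)) gt_eqF //=.
  by move/eqP.
- by move=> i iA; rewrite diag01_mul (negPf iA).
- move=> i iA; rewrite /gram -mulmxA yE -scalemxAr mxE.
  by rewrite diag01_mul iA.
Qed.

(** An operator and its adjoint have the same norm: the bound of [comp_norm_psd] on [diag01 A *m V]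
    is passed to its adjoint applied to [y]. *)
Lemma comp_norm_ge (A : {set 'I_n}) (y : 'cV[R[i]]_n) :
  (forall i, i \notin A -> y i 0 = 0) ->
  complex.Re ((adjmx y *m G *m y) 0 0) <= comp_norm f A * sqnorm y.
Proof.
move=> yA; have [[x x0 xE] lb] := comp_norm_psd A.
set l := comp_norm f A in lb xE *.
have l0 : 0 <= l.
  rewrite -(pmulr_lge0 _ (_ : 0 < sqnorm x)) 1?lt_def ?sqnorm_eq0 ?x0 ?sqnorm_ge0 //.
  exact: le_trans (sqnorm_ge0 _) (lb x).
pose w := adjmx V *m y; pose z := diag01 A *m (V *m w).
have zq : sqnorm z <= l * sqnorm w by apply: lb.
have -> : adjmx y *m G *m y = adjmx w *m w by rewrite adjmxM adjmxK !mulmxA.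
rewrite adjmx_mul_self /=.
have yz : adjmx y *m z = adjmx w *m w.
  have -> : adjmx y *m z = adjmx (diag01 A *m y) *m (V *m w).
    by rewrite adjmxM adjmx_diag01 !mulmxA.
  by rewrite diag01_id // adjmxM adjmxK !mulmxA.
have zy : adjmx z *m y = adjmx w *m w.
  by rewrite -[LHS]adjmxK adjmxM adjmxK yz adjmxM adjmxK.
(* This is nonnegative; together with [sqnorm z <= l * sqnorm w] it gives
   [l * sqnorm w <= l ^+ 2 * sqnorm y], to be divided by [l]. *)
have nn : sqnorm (l%:C *: y - z) = l ^+ 2 * sqnorm y - 2 * l * sqnorm w + sqnorm z.
  apply: (@complexI R); rewrite -adjmx_mul_self.
  have -> : adjmx (l%:C *: y - z) = l%:C *: adjmx y - adjmx z.
    by apply/rowP => j; rewrite !mxE rmorphB rmorphM /= oppr0.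
  rewrite mulmxBl !mulmxBr -!scalemxAl -!scalemxAr yz zy.
  have rB (A' B' : 'M[R[i]]_1) : (A' - B') 0 0 = A' 0 0 - B' 0 0 by rewrite !mxE.
  have rZ c (A' : 'M[R[i]]_1) : (c *: A') 0 0 = c * A' 0 0 by rewrite mxE.
  rewrite !(rB, rZ) !adjmx_mul_self !(rmorphD, rmorphB, rmorphM, rmorphXn) /=.
  by ring.
have := sqnorm_ge0 (l%:C *: y - z); rewrite nn => nn0.
have [l00|lp] := eqVneq l 0; last first.
  have lp' : 0 < l by rewrite lt_def lp l0.
  by rewrite -(ler_pM2l lp'); nra.
(* Division fails for [l = 0], but then [z = 0], and [sqnorm w] is the inner product of [z] and
   [y]. *)
rewrite l00 mul0r; move: zq; rewrite l00 mul0r => z0.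
have zz : z = 0.
  by apply/eqP; rewrite -sqnorm_eq0 eq_le z0 sqnorm_ge0.
move: yz; rewrite zz mulmx0 => /matrixP/(_ 0 0); rewrite adjmx_mul_self mxE.
by case=> <-.
Qed.

Lemma comp_norm_ge_diag (A : {set 'I_n}) i :
  i \in A -> complex.Re (G i i) <= comp_norm f A.
Proof.
move=> iA.
have := @comp_norm_ge A (delta_mx i 0).
have -> : sqnorm (delta_mx i 0 : 'cV[R[i]]_n) = 1.
  rewrite /sqnorm (bigD1 i) //= big1 => [|j ji].
    by rewrite !mxE !eqxx -[1%:R]/(1%:C) abs2_real expr1n addr0.
  by rewrite mxE (negPf ji) /=; apply/eqP; rewrite abs2_eq0.
have -> : adjmx (delta_mx i 0 : 'cV[R[i]]_n) = delta_mx 0 i.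
  by apply/rowP => j; rewrite !mxE conjc_nat andbC.
rewrite -rowE -colE !mxE mulr1; apply => j jA; rewrite mxE.
by case: eqVneq jA => // ->; rewrite iA.
Qed.

End Frames.

(** * Characteristic polynomials of principal submatrices of size at most four *)

Section SmallDeterminants.
Variable F : idomainType.

Definition det3 (a11 a12 a13 a21 a22 a23 a31 a32 a33 : F) : F :=
  a11 * (a22 * a33 - a23 * a32) - a12 * (a21 * a33 - a23 * a31)
  + a13 * (a21 * a32 - a22 * a31).

(** Weighting the equations by the cofactors of the first column leaves the determinant times
    [x1]. *)
Lemma det3_cramer a11 a12 a13 a21 a22 a23 a31 a32 a33 x1 x2 x3 :
  a11 * x1 + a12 * x2 + a13 * x3 = 0 ->
  a21 * x1 + a22 * x2 + a23 * x3 = 0 ->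
  a31 * x1 + a32 * x2 + a33 * x3 = 0 ->
  x1 != 0 -> det3 a11 a12 a13 a21 a22 a23 a31 a32 a33 = 0.
Proof.
move=> e1 e2 e3 x0; apply: (mulIf x0); rewrite mul0r.
have -> : det3 a11 a12 a13 a21 a22 a23 a31 a32 a33 * x1 =
  (a22 * a33 - a23 * a32) * (a11 * x1 + a12 * x2 + a13 * x3)
  - (a12 * a33 - a13 * a32) * (a21 * x1 + a22 * x2 + a23 * x3)
  + (a12 * a23 - a13 * a22) * (a31 * x1 + a32 * x2 + a33 * x3).
  by rewrite /det3; ring.
by rewrite e1 e2 e3 !mulr0 subrr addr0.
Qed.

Definition det4 (a11 a12 a13 a14 a21 a22 a23 a24 a31 a32 a33 a34
                 a41 a42 a43 a44 : F) : F :=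
  a11 * det3 a22 a23 a24 a32 a33 a34 a42 a43 a44
  - a21 * det3 a12 a13 a14 a32 a33 a34 a42 a43 a44
  + a31 * det3 a12 a13 a14 a22 a23 a24 a42 a43 a44
  - a41 * det3 a12 a13 a14 a22 a23 a24 a32 a33 a34.

Lemma det4_cramer a11 a12 a13 a14 a21 a22 a23 a24 a31 a32 a33 a34
    a41 a42 a43 a44 x1 x2 x3 x4 :
  a11 * x1 + a12 * x2 + a13 * x3 + a14 * x4 = 0 ->
  a21 * x1 + a22 * x2 + a23 * x3 + a24 * x4 = 0 ->
  a31 * x1 + a32 * x2 + a33 * x3 + a34 * x4 = 0 ->
  a41 * x1 + a42 * x2 + a43 * x3 + a44 * x4 = 0 ->
  x1 != 0 ->
  det4 a11 a12 a13 a14 a21 a22 a23 a24 a31 a32 a33 a34 a41 a42 a43 a44 = 0.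
Proof.
move=> e1 e2 e3 e4 x0; apply: (mulIf x0); rewrite mul0r.
have -> : det4 a11 a12 a13 a14 a21 a22 a23 a24 a31 a32 a33 a34
               a41 a42 a43 a44 * x1 =
  det3 a22 a23 a24 a32 a33 a34 a42 a43 a44
    * (a11 * x1 + a12 * x2 + a13 * x3 + a14 * x4)
  - det3 a12 a13 a14 a32 a33 a34 a42 a43 a44
    * (a21 * x1 + a22 * x2 + a23 * x3 + a24 * x4)
  + det3 a12 a13 a14 a22 a23 a24 a42 a43 a44
    * (a31 * x1 + a32 * x2 + a33 * x3 + a34 * x4)
  - det3 a12 a13 a14 a22 a23 a24 a32 a33 a34
    * (a41 * x1 + a42 * x2 + a43 * x3 + a44 * x4).
  by rewrite /det4 /det3; ring.
by rewrite e1 e2 e3 e4 !mulr0 !subr0 addr0.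
Qed.

(** For duplicate-free [s] this is the eigenvector equation of the principal submatrix on [s].
    Listing the indices allows explicit expansion of the sums. *)
Definition eigen_eq (I : eqType) (Q : I -> I -> F) (s : seq I) (v : F)
    (y : I -> F) : Prop :=
  forall i, i \in s -> \sum_(j <- s) Q i j * y j = v * y i.

Definition eigen_on (I : eqType) (Q : I -> I -> F) (s : seq I) (v : F) : Prop :=
  exists2 y : I -> F, (exists2 i, i \in s & y i != 0) & eigen_eq Q s v y.

Lemma eigen_eq_perm (I : eqType) (Q : I -> I -> F) (s s' : seq I) v y :
  perm_eq s s' -> eigen_eq Q s v y -> eigen_eq Q s' v y.
Proof.
by move=> ss' yE j js; rewrite -(perm_big _ ss') yE // (perm_mem ss').
Qed.

Section ZeroDiagonal.
Variables (I : eqType) (Q : I -> I -> F).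
Hypothesis Q0 : forall i, Q i i = 0.

Lemma eigen_on2 a b v : eigen_on Q [:: a; b] v -> v ^+ 2 = Q a b * Q b a.
Proof.
move=> [y [i is_ yi] yE].
have ea := yE a; have eb := yE b.
move: ea eb; rewrite !big_cons !big_nil !inE !eqxx !orbT !Q0 !(mul0r, addr0, add0r).
move=> /(_ isT) ea /(_ isT) eb.
move: is_; rewrite !inE => /orP[] /eqP ii; rewrite ii in yi; apply: (mulIf yi).
  by rewrite expr2 -!mulrA -ea eb; ring.
by rewrite expr2 -!mulrA -eb [RHS]mulrCA ea; ring.
Qed.

Hypothesis Q1 : forall i j, i != j -> Q i j * Q j i = 1.

(** The left side is the determinant of [v I - Q] on the three indices; each of the three
    transpositions contributes [Q i j * Q j i = 1]. *)
Lemma eigen_eq3 a b c v y : uniq [:: a; b; c] -> y a != 0 ->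
  eigen_eq Q [:: a; b; c] v y ->
  v ^+ 3 - 3 * v - (Q a b * Q b c * Q c a + Q a c * Q c b * Q b a) = 0.
Proof.
rewrite /= !inE !negb_or => /and3P[/andP[ab ac] bc _] ya yE.
have ea := yE a; have eb := yE b; have ec := yE c; move: ea eb ec.
rewrite !big_cons !big_nil !inE !eqxx !orbT !Q0 !(mul0r, addr0, add0r).
move=> /(_ isT) ea /(_ isT) eb /(_ isT) ec.
have D : det3 v (- Q a b) (- Q a c) (- Q b a) v (- Q b c) (- Q c a) (- Q c b) v = 0.
  apply: (@det3_cramer _ _ _ _ _ _ _ _ _ (y a) (y b) (y c)) ya.
  - by rewrite -ea; ring.
  - by rewrite -eb; ring.
  - by rewrite -ec; ring.
rewrite -[RHS]D /det3.
have -> : 3 * v = v * (Q a b * Q b a) + v * (Q b c * Q c b) + v * (Q a c * Q c a).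
  by rewrite !Q1 //; ring.
by ring.
Qed.

(** A rotation of the list brings a nonzero coordinate to the front and leaves the polynomial
    unchanged. *)
Lemma eigen_on3 a b c v : uniq [:: a; b; c] -> eigen_on Q [:: a; b; c] v ->
  v ^+ 3 - 3 * v - (Q a b * Q b c * Q c a + Q a c * Q c b * Q b a) = 0.
Proof.
move=> us [y [i is_ yi] yE].
have gen r (s' := rot r [:: a; b; c]) : uniq s' /\ eigen_eq Q s' v y.
  by rewrite rot_uniq; split => //; apply: eigen_eq_perm yE; rewrite perm_sym perm_rot.
move: is_; rewrite !inE => /or3P[] /eqP ii; rewrite ii in yi.
- exact: eigen_eq3 us yi yE.
- have [us1 y1] := gen 1%N; rewrite -[RHS](eigen_eq3 us1 yi y1); ring.
- have [us1 y1] := gen 2%N; rewrite -[RHS](eigen_eq3 us1 yi y1); ring.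
Qed.

(** The contribution of the six 4-cycles to the determinant: three Hamiltonian cycles on four
    points, each in both orientations. *)
Definition four_cycles a b c d :=
  Q a b * Q b c * Q c d * Q d a + Q a d * Q d c * Q c b * Q b a
  + (Q a c * Q c d * Q d b * Q b a + Q a b * Q b d * Q d c * Q c a)
  + (Q a d * Q d b * Q b c * Q c a + Q a c * Q c b * Q b d * Q d a).

Definition three_cycles a b c d :=
  Q a b * Q b c * Q c a + Q a c * Q c b * Q b a
  + (Q a c * Q c d * Q d a + Q a d * Q d c * Q c a)
  + (Q a d * Q d b * Q b a + Q a b * Q b d * Q d a)
  + (Q b c * Q c d * Q d b + Q b d * Q d c * Q c b).

(** Again a characteristic polynomial: 6 counts the transpositions and 3 the products of two
    disjoint ones, each contributing a product of factors [Q i j * Q j i = 1]. *)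
Lemma eigen_eq4 a b c d v y : uniq [:: a; b; c; d] -> y a != 0 ->
  eigen_eq Q [:: a; b; c; d] v y ->
  v ^+ 4 - 6 * v ^+ 2 - v * three_cycles a b c d + 3 - four_cycles a b c d = 0.
Proof.
rewrite /= !inE !negb_or => /and4P[/and3P[ab ac ad] /andP[bc bd] cd _] ya yE.
have ea := yE a; have eb := yE b; have ec := yE c; have ed := yE d.
move: ea eb ec ed.
rewrite !big_cons !big_nil !inE !eqxx !orbT !Q0 !(mul0r, addr0, add0r).
move=> /(_ isT) ea /(_ isT) eb /(_ isT) ec /(_ isT) ed.
have D : det4 v (- Q a b) (- Q a c) (- Q a d) (- Q b a) v (- Q b c) (- Q b d)
   (- Q c a) (- Q c b) v (- Q c d) (- Q d a) (- Q d b) (- Q d c) v = 0.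
  apply: (@det4_cramer _ _ _ _ _ _ _ _ _ _ _ _ _ _ _ _ (y a) (y b) (y c) (y d)) ya.
  - by rewrite -ea; ring.
  - by rewrite -eb; ring.
  - by rewrite -ec; ring.
  - by rewrite -ed; ring.
rewrite -[RHS]D /det4 /det3 /three_cycles /four_cycles.
have -> : 6 * v ^+ 2 = v ^+ 2 * (Q a b * Q b a + Q a c * Q c a + Q a d * Q d a
    + Q b c * Q c b + Q b d * Q d b + Q c d * Q d c).
  by rewrite !Q1 //; ring.
have -> : 3 = Q a b * Q b a * (Q c d * Q d c) + Q a c * Q c a * (Q b d * Q d b)
    + Q a d * Q d a * (Q b c * Q c b).
  by rewrite !Q1 //; ring.
by ring.
Qed.

Lemma eigen_on4 a b c d v : uniq [:: a; b; c; d] -> eigen_on Q [:: a; b; c; d] v ->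
  v ^+ 4 - 6 * v ^+ 2 - v * three_cycles a b c d + 3 - four_cycles a b c d = 0.
Proof.
move=> us [y [i is_ yi] yE].
have gen r (s' := rot r [:: a; b; c; d]) : uniq s' /\ eigen_eq Q s' v y.
  by rewrite rot_uniq; split => //; apply: eigen_eq_perm yE; rewrite perm_sym perm_rot.
move: is_; rewrite !inE => /or4P[] /eqP ii; rewrite ii in yi.
- exact: eigen_eq4 us yi yE.
- have [us1 y1] := gen 1%N; rewrite -[RHS](eigen_eq4 us1 yi y1).
  by rewrite /three_cycles /four_cycles; ring.
- have [us1 y1] := gen 2%N; rewrite -[RHS](eigen_eq4 us1 yi y1).
  by rewrite /three_cycles /four_cycles; ring.
- have [us1 y1] := gen 3%N; rewrite -[RHS](eigen_eq4 us1 yi y1).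
  by rewrite /three_cycles /four_cycles; ring.
Qed.

End ZeroDiagonal.
End SmallDeterminants.

(** * The tournament given by the signs of the imaginary parts of triple products *)

Section TripleProducts.
Local Open Scope complex_scope.
Variables (R : rcfType) (n : nat) (Q : 'I_n -> 'I_n -> R[i]).
Hypothesis Q0 : forall i, Q i i = 0.
Hypothesis Qc : forall i j, conjc (Q i j) = Q j i.
Hypothesis Q1 : forall i j, i != j -> Q i j * Q j i = 1.

(** Diagonal conjugation of [Q] leaves these products unchanged, which makes them suited to
    switching classes. *)
Definition triple a b c := Q a b * Q b c * Q c a.
Local Notation E a b c := (complex.Im (triple a b c)).

Lemma triple_conj a b c : conjc (triple a b c) = triple a c b.
Proof. by rewrite /triple !rmorphM /= !Qc; ring. Qed.

Lemma Im_triple_swap a b c : E a c b = - E a b c.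
Proof. by rewrite -triple_conj; case: (triple a b c). Qed.

Lemma Im_triple_deg a b : (E a b a = 0) * (E a b b = 0).
Proof. by rewrite /triple !Q0 !(mulr0, mul0r). Qed.

(** On the right each edge at [a] is traversed once in each direction and cancels. *)
Lemma triple_cocycle a b c d : uniq [:: a; b; c; d] ->
  triple b c d = triple a b c * triple a c d * triple a d b.
Proof.
rewrite /= !inE !negb_or => /and4P[/and3P[ab ac ad] /andP[bc bd] cd _].
have -> : triple a b c * triple a c d * triple a d b =
  triple b c d * (Q a b * Q b a) * (Q a c * Q c a) * (Q a d * Q d a).
  by rewrite /triple; ring.
by rewrite !Q1 // !mulr1.
Qed.

(** [t] and [s] are the constants supplied by 3- and 4-uniformity, and [mu] comes from idempotence
    of the Gram matrix. For frames [t2_neq1] follows from [nontrivial_ratio]. *)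
Variables (t s mu : R).
Hypothesis Re_triple : forall a b c, uniq [:: a; b; c] ->
  complex.Re (triple a b c) = t.
Hypothesis Im_triple_sum : forall a b c d, uniq [:: a; b; c; d] ->
  E a b c * E a c d + E a c d * E a d b + E a d b * E a b c = s.
Hypothesis Q_sqr : forall a b, a != b -> \sum_l Q a l * Q l b = mu%:C * Q a b.
Hypothesis t2_neq1 : t ^+ 2 != 1.
Hypothesis n_gt3 : (3 < n)%N.

Lemma Im_triple_sqr a b c : uniq [:: a; b; c] -> E a b c ^+ 2 = 1 - t ^+ 2.
Proof.
move=> u; have := Re_triple u.
have : triple a b c * conjc (triple a b c) = 1.
  rewrite triple_conj; move: u; rewrite /= !inE !negb_or.
  move=> /and3P[/andP[ab ac] bc _].
  have -> : triple a b c * triple a c b =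
     (Q a b * Q b a) * (Q b c * Q c b) * (Q a c * Q c a) by rewrite /triple; ring.
  by rewrite !Q1 // !mulr1.
rewrite mul_conjc /abs2 => -[<-] <-; ring.
Qed.

Lemma Im_triple_neq0 a b c : uniq [:: a; b; c] -> E a b c != 0.
Proof.
move=> u; rewrite -sqrf_eq0 Im_triple_sqr // subr_eq0 eq_sym; exact: t2_neq1.
Qed.

(** The sum of [triple a b l] over [l] is [Q a b] times the entry of [Q^2] at [b, a], that is, the
    real number [mu]. This is the balance at the vertex [b]. *)
Lemma Im_triple_total a b : a != b -> \sum_l E a b l = 0.
Proof.
move=> ab; rewrite -Im_sum.
have -> : \sum_l triple a b l = mu%:C.
  rewrite -[RHS]mulr1 -(Q1 ab) [RHS]mulrCA -Q_sqr 1?eq_sym // mulr_sumr.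
  by apply: eq_bigr => l _; rewrite /triple mulrA.
by [].
Qed.

Lemma uniq4_fix_rot (a b c d : 'I_n) :
  uniq [:: a; b; c; d] -> uniq [:: a; c; d; b] /\ uniq [:: a; b; c].
Proof.
rewrite /= !inE !negb_or => /and4P[/and3P[ab ac ad] /andP[bc bd] cd _].
by rewrite ab ac ad bc cd eq_sym bc eq_sym bd.
Qed.

Lemma Im_triple_pos : exists a b c, uniq [:: a; b; c] /\ 0 < E a b c.
Proof.
pose o i (h : (i < 4)%N) : 'I_n := Ordinal (leq_trans h n_gt3).
pose a := o 0%N isT; pose b := o 1%N isT; pose c := o 2%N isT.
have u : uniq [:: a; b; c] by [].
have := Im_triple_neq0 u; rewrite neq_lt => /orP[lt0|]; last by exists a, b, c.
by exists a, c, b; rewrite Im_triple_swap oppr_gt0.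
Qed.

(* With [s = -(1 - t^2)] no triangle is cyclic, so [E a b c > 0] implies
   [E a c l <= E a b l] for all [l], against [Im_triple_total]. *)
Lemma Im_triple_sum_neq : s != - (1 - t ^+ 2).
Proof.
apply/eqP => sE; have [a [b [c [u abc]]]] := Im_triple_pos.
move: (u); rewrite /= !inE !negb_or => /and3P[/andP[ab ac] bc _].
have le l : E a c l <= E a b l.
  have [->|la] := eqVneq l a; first by rewrite !Im_triple_deg.
  have [->|lb] := eqVneq l b.
    by rewrite Im_triple_swap Im_triple_deg oppr_le0 ltW.
  have [->|lc] := eqVneq l c; first by rewrite Im_triple_deg ltW.
  have u4 : uniq [:: a; b; c; l].
    by rewrite /= !inE !negb_or ab ac bc (eq_sym a) la (eq_sym b) lb (eq_sym c) lc.
  have uabl : uniq [:: a; b; l].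
    by rewrite /= !inE !negb_or ab (eq_sym a) la (eq_sym b) lb.
  have uacl : uniq [:: a; c; l].
    by rewrite /= !inE !negb_or ac (eq_sym a) la (eq_sym c) lc.
  have := Im_triple_sum u4; rewrite sE [E a l b]Im_triple_swap.
  have := Im_triple_sqr u; have := Im_triple_sqr uabl; have := Im_triple_sqr uacl.
  (* The sum condition factors as [(x + y) * (x - z) = 0], where [x], [y], [z] have equal squares
     and [x > 0]; either factor gives [y <= z]. *)
  move: abc; set x := E a b c; set y := E a c l; set z := E a b l.
  by move=> *; nra.
have := Im_triple_total ab; have := Im_triple_total ac => Sc Sb.
suff : \sum_l E a c l < \sum_l E a b l by rewrite Sc Sb ltxx.
(* At [l = c] the inequality is strict, since [E a c c = 0 < E a b c]. *)
rewrite (bigD1 c) //= [ltRHS](bigD1 c) //= ltr_leD //.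
  by rewrite Im_triple_deg.
by apply: ler_sum.
Qed.

(** The three numbers in the sum condition agree up to sign. Unless all are equal, their pairwise
    products add up to [- (1 - t ^+ 2)], the value just excluded. *)
Lemma triangle_cyclic a b c d : uniq [:: a; b; c; d] -> E a b c = E a c d.
Proof.
move=> u.
have := Im_triple_sum_neq; have := Im_triple_sum u.
have ud : uniq [:: a; d; b].
  move: u; rewrite /= !inE !negb_or => /and4P[/and3P[ab ac ad] /andP[bc bd] cd _].
  by rewrite ad ab eq_sym bd.
have [uc ub] := uniq4_fix_rot u; have [_ ucd] := uniq4_fix_rot uc.
have := Im_triple_sqr ub; have := Im_triple_sqr ucd; have := Im_triple_sqr ud.
have := Im_triple_neq0 ub.
set x := E a b c; set y := E a c d; set z := E a d b => x0 z2 y2 x2 <- neq.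
apply/eqP; move: neq; apply: contra_neqT => xy.
have yx : y = - x.
  have : (x - y) * (x + y) = 0 by ring: x2 y2.
  by move/eqP; rewrite mulf_eq0 subr_eq0 (negPf xy) /= addrC addr_eq0 => /eqP.
by rewrite yx -x2; ring.
Qed.

Lemma four_points : n = 4%N /\ t = 0.
Proof.
have [a [b [c [u abc]]]] := Im_triple_pos.
move: (u); rewrite /= !inE !negb_or => /and3P[/andP[ab ac] bc _].
have uf d : d \notin [:: a; b; c] -> uniq [:: a; b; c; d].
  move=> dn; rewrite -(perm_uniq (_ : perm_eq (d :: [:: a; b; c]) _)).
    by rewrite /= dn; exact: u.
  by rewrite -[[:: a; b; c; d]]/(rot 1 [:: d; a; b; c]) perm_sym perm_rot.
split.
- pose w := E a b c.
  (* By cyclicity the value is [- w] for every [l] outside [a], [b], [c]; the indicators correct it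
     to 0, 0 and [w] there. Summation over [l] gives [w * (4 - n) = 0]. *)
  have sumE l : E a b l = - w + w * (l == a)%:R + w * (l == b)%:R + 2 * w * (l == c)%:R.
    have [->|la] := eqVneq l a.
      by rewrite Im_triple_deg (negPf ab) (negPf ac) /=; ring.
    have [->|lb] := eqVneq l b.
      by rewrite Im_triple_deg (negPf bc) /=; ring.
    have [->|lc] := eqVneq l c; first by rewrite /w /=; ring.
    rewrite !mulr0 !addr0 Im_triple_swap /w.
    have ul : uniq [:: a; b; c; l] by apply: uf; rewrite !inE !negb_or la lb lc.
    by have [ul' _] := uniq4_fix_rot ul; rewrite (triangle_cyclic ul) (triangle_cyclic ul').
  have delta i : \sum_(l < n) (l == i)%:R = 1 :> R.
    by rewrite (bigD1 i) //= eqxx big1 ?addr0 // => j /negPf ->.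
  have := Im_triple_total ab; under eq_bigr do rewrite sumE.
  rewrite !big_split /= -!mulr_sumr !delta sumr_const card_ord -mulr_natr => S.
  have : w * (4 - n%:R) = 0 by rewrite -{}[RHS]S; ring.
  move/eqP; rewrite mulf_eq0 gt_eqF //= subr_eq0 eqr_nat => /eqP; exact: esym.
- have [d dn] : exists d, d \notin [:: a; b; c].
    apply/existsP; rewrite -[X in is_true X]negbK negb_exists; apply/negP => /forallP H.
    have : (n <= 3)%N.
      rewrite -(size_enum_ord n) (@uniq_leq_size _ _ [:: a; b; c]) ?enum_uniq //.
      by move=> x _; have := H x; rewrite negbK.
    by rewrite leqNgt n_gt3.
  have ud := uf _ dn; have [uc ub] := uniq4_fix_rot ud; have [ucc ucd] := uniq4_fix_rot uc.
  have [_ udb] := uniq4_fix_rot ucc.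
  have e1 := triangle_cyclic ud; have e2 := triangle_cyclic uc.
  have := Im_triple_sqr ub.
  have ubcd : uniq [:: b; c; d] by move: ud => /= /andP[].
  have := Re_triple ubcd; rewrite (triple_cocycle ud).
  move: (Re_triple ub) (Re_triple ucd) (Re_triple udb) e1 e2 abc.
  case: (triple a b c) (triple a c d) (triple a d b) => [x x'] [y y'] [z z'] /=.
  move=> -> -> -> <- <- x0 E1 x2.
  (* The three triple products at [a] all equal [t + i x'], so the cocycle relation gives
     [t = t^3 - 3 t x'^2], while [t^2 + x'^2 = 1]. *)
  have : t * (4 * x' ^+ 2) = 0 by rewrite -[RHS]oppr0 -(subrr t) -{2}E1; ring: x2.
  move/eqP; rewrite mulf_eq0 => /orP[/eqP //|].
  by rewrite mulf_eq0 pnatr_eq0 sqrf_eq0 /= (gt_eqF x0).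
Qed.

End TripleProducts.

(** * The switching class of the 4 by 4 matrix *)

Section Switching.
Local Open Scope complex_scope.
Variable R : rcfType.

Lemma unimodular_neq0 (z : R[i]) : abs2 z = 1 -> z != 0.
Proof. by move=> z1; rewrite -abs2_eq0 z1 oner_eq0. Qed.

Lemma switchingE n (S : 'M[R[i]]_n) (s : 'S_n) (d : 'rV[R[i]]_n) i j :
  (forall i, abs2 (d 0 i) = 1) ->
  (perm_mx s *m diag_mx d *m S *m invmx (diag_mx d) *m invmx (perm_mx s)) i j =
  d 0 (s i) * S (s i) (s j) * (d 0 (s j))^-1.
Proof.
move=> d1.
have inv (A B : 'M[R[i]]_n) : A *m B = 1%:M -> invmx A = B.
  by move=> AB; have [Au _] := mulmx1_unit AB; rewrite -[LHS]mulmx1 -AB mulKmx.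
rewrite (inv _ (diag_mx (\row_i (d 0 i)^-1))); last first.
  rewrite mulmx_diag -diag_const_mx; congr diag_mx; apply/rowP => l.
  by rewrite !mxE divff // unimodular_neq0.
rewrite (inv _ (perm_mx s^-1)); last by rewrite -perm_mxM mulgV perm_mx1.
rewrite -col_permE -!mulmxA -row_permE.
by rewrite mul_diag_mx mul_mx_diag !mxE mulrA.
Qed.

Lemma S4_diag i : S4 R i i = 0.
Proof. by case: i => [[|[|[|[|//]]]] hi]; rewrite mxE. Qed.

Lemma S4_unimodular i j : i != j -> S4 R i j * S4 R j i = 1.
Proof.
have ii : 'i%C * 'i%C = -1 :> R[i] by rewrite -expr2 sqr_i.
case: i => [[|[|[|[|//]]]] hi]; case: j => [[|[|[|[|//]]]] hj] //;
  rewrite !mxE /= ?mulr1 // ?mulNr ?mulrN ?ii ?opprK //.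
Qed.

Lemma S4_triple i j l : uniq [:: i; j; l] -> complex.Re (triple (S4 R) i j l) = 0.
Proof.
case: i => [[|[|[|[|//]]]] hi]; case: j => [[|[|[|[|//]]]] hj] //;
case: l => [[|[|[|[|//]]]] hl] // _; rewrite /triple !mxE /=; ring.
Qed.

(** The diagonal factors cancel around every closed walk and permutations only relabel, so each
    property can be read off [S4]. *)
Lemma switching_S4_props n (Q : 'M[R[i]]_n) : switching_equiv4 Q (S4 R) ->
  [/\ n = 4%N, forall i, Q i i = 0, forall i j, i != j -> Q i j * Q j i = 1 &
      forall i j l, uniq [:: i; j; l] -> complex.Re (triple Q i j l) = 0].
Proof.
case=> h [s [d [d1 QE]]]; subst n; rewrite castmx_id in QE.
have {}QE i j : Q i j = d 0 (s i) * S4 R (s i) (s j) * (d 0 (s j))^-1.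
  by rewrite QE switchingE.
have d0 i : d 0 i != 0 by apply: unimodular_neq0.
split => // [i|i j ij|i j l u].
- by rewrite QE S4_diag mulr0 mul0r.
- rewrite !QE -[RHS](@S4_unimodular (s i) (s j)) ?(inj_eq perm_inj) //.
  by field; rewrite !d0.
- rewrite -[RHS](@S4_triple (s i) (s j) (s l)).
    by congr complex.Re; rewrite /triple !QE; field; rewrite !d0.
  by rewrite -[[:: _; _; _]]/(map s [:: i; j; l]) map_inj_uniq //; apply: perm_inj.
Qed.

(** Switching by the entries [Q i 0] turns row and column 0 into ones; the other entries then become
    the triple products through 0. Cyclicity leaves a single sign [e] to be determined. *)
Lemma switching_S4_of_triples (Q : 'M[R[i]]_4) :
  (forall i, Q i i = 0) -> (forall i j, conjc (Q i j) = Q j i) ->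
  (forall i j, i != j -> Q i j * Q j i = 1) ->
  (forall a b c, uniq [:: a; b; c] -> complex.Re (triple Q a b c) = 0) ->
  (forall a b c d, uniq [:: a; b; c; d] ->
     complex.Im (triple Q a b c) = complex.Im (triple Q a c d)) ->
  switching_equiv4 Q (S4 R).
Proof.
move=> Q0 Qc Q1 Re0 cyc.
pose o0 := @Ordinal 4 0 isT; pose o1 := @Ordinal 4 1 isT.
pose o2 := @Ordinal 4 2 isT; pose o3 := @Ordinal 4 3 isT.
pose d' i := if i == o0 then 1 else Q i o0.
suff [s [s0 sE]] : exists s : 'S_4, s o0 = o0 /\ forall i j, i != o0 -> j != o0 ->
    S4 R (s i) (s j) = triple Q o0 i j.
  exists erefl, s, (\row_i d' (s^-1%g i)).
  have d1 i : abs2 (d' i) = 1.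
    apply: (@complexI R); rewrite -mul_conjc /d'.
    by case: (eqVneq i o0) => [_|i0]; rewrite ?conjc1 ?mulr1 ?Qc ?Q1.
  split=> [i|]; first by rewrite mxE.
  apply/matrixP => i j; rewrite castmx_id switchingE; last by move=> l; rewrite mxE.
  have dE l : (\row_i d' (s^-1%g i)) 0 (s l) = d' l by rewrite mxE permK.
  rewrite !dE /d'.
  have S0 l : l != o0 -> (S4 R o0 l = 1) * (S4 R l o0 = 1).
    by case: l => [[|[|[|[|//]]]] hl] //; rewrite !mxE.
  have s_neq0 l : l != o0 -> s l != o0 by rewrite -{2}s0 (inj_eq perm_inj).
  have QV l : l != o0 -> (Q l o0)^-1 = Q o0 l.
    move=> l0; have := Q1 _ _ l0; have [->|q0] := eqVneq (Q l o0) 0.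
      by move/eqP; rewrite mul0r eq_sym oner_eq0.
    by move=> e; apply: (mulfI q0); rewrite divff // e.
  have [->|i0] := eqVneq i o0; have [->|j0] := eqVneq j o0.
  - by rewrite !s0 S4_diag Q0 mulr0 mul0r.
  - by rewrite s0 S0 ?s_neq0 // !mul1r QV.
  - by rewrite s0 S0 ?s_neq0 // invr1 !mulr1.
  rewrite sE // QV // /triple.
  have -> : Q i o0 * (Q o0 i * Q i j * Q j o0) * Q o0 j =
    Q i j * (Q i o0 * Q o0 i) * (Q j o0 * Q o0 j) by ring.
  by rewrite !Q1 // !mulr1.
pose e := complex.Im (triple Q o0 o1 o2).
have TE i j l : uniq [:: i; j; l] ->
    triple Q i j l = (complex.Im (triple Q i j l))%:C * 'i%C.
  by move/Re0; case: (triple Q i j l) => x y /= ->; simpc.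
have e2 : e * e = 1.
  have := @Im_triple_sqr _ _ Q Qc Q1 0 Re0 o0 o1 o2 isT.
  by rewrite -/e expr0n subr0 expr2.
have E23 : complex.Im (triple Q o0 o2 o3) = e by rewrite -(cyc o0 o1 o2 o3).
have E31 : complex.Im (triple Q o0 o3 o1) = e by rewrite -(cyc o0 o2 o3 o1).
have Qsw a b c : complex.Im (triple Q a c b) = - complex.Im (triple Q a b c).
  exact: Im_triple_swap.
have [T12 T23 T31] : [/\ triple Q o0 o1 o2 = e%:C * 'i%C,
    triple Q o0 o2 o3 = e%:C * 'i%C & triple Q o0 o3 o1 = e%:C * 'i%C].
  by split; rewrite TE // ?E23 ?E31.
have [T21 T32 T13] : [/\ triple Q o0 o2 o1 = - (e%:C * 'i%C),
    triple Q o0 o3 o2 = - (e%:C * 'i%C) & triple Q o0 o1 o3 = - (e%:C * 'i%C)].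
  by split; rewrite TE // Qsw ?E23 ?E31 rmorphN mulNr.
have Td i : triple Q o0 i i = 0 by rewrite /triple Q0 mulr0 mul0r.
have ordE (i : 'I_4) : i != o0 -> [\/ i = o1, i = o2 | i = o3].
  by case: i => [[|[|[|[|//]]]] hi] // _;
    [apply: Or31|apply: Or32|apply: Or33]; apply: val_inj.
have : (e - 1) * (e + 1) = 0 by ring: e2.
move/eqP; rewrite mulf_eq0 subr_eq0 addr_eq0 => /orP[] /eqP ev.
(* [S4] has entry [- 'i] at [1, 2], hence corresponds to [e = -1]; for [e = 1] exchanging 1 and 2
   reverses the cyclic orientation. *)
- have t0 : tperm o1 o2 o0 = o0 by rewrite tpermD.
  have t3 : tperm o1 o2 o3 = o3 by rewrite tpermD.
  exists (tperm o1 o2); split => // i j /ordE[] -> /ordE[] ->;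
  rewrite ?tpermL ?tpermR ?t3 ?Td ?T12 ?T23 ?T31 ?T21 ?T32 ?T13 ?S4_diag // ev mxE /=;
  by simpc.
- exists 1%g; split => [|i j /ordE[] -> /ordE[] ->]; first by rewrite perm1.
  all: rewrite !perm1 ?Td ?T12 ?T23 ?T31 ?T21 ?T32 ?T13 ?S4_diag // ev mxE /=;
  by simpc.
Qed.

End Switching.

(** * From the Gram matrix to the Seidel matrix *)

Section SeidelMatrix.
Local Open Scope complex_scope.
Variables (R : realType) (realF : bool) (n k : nat) (f : 'I_n -> 'cV[R[i]]_k).
Hypothesis f_parseval : parseval_frame realF f.
Hypothesis k_gt0 : (0 < k)%N.
Hypothesis k_ltn : (k < n)%N.
Hypothesis n_gt1 : (1 < n)%N.
Local Notation G := (gram f).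
Local Notation Q := (seidel f).
Local Notation a := (k%:R / n%:R : R).
Local Notation c := (cnk R n k).
Local Notation lam := (comp_norm realF f).

Lemma n_neq0 : n%:R != 0 :> R.
Proof. by rewrite pnatr_eq0 -lt0n (leq_trans _ n_gt1). Qed.

Lemma n1_gt0 : 0 < n%:R - 1 :> R.
Proof. by rewrite subr_gt0 ltr1n. Qed.

(** This normalization is what puts [n - 1] on the diagonal in [seidel_sqr]. *)
Lemma cnk_sqr : c ^+ 2 * (n%:R - 1) = a * (1 - a).
Proof.
have n0 := n_neq0; have n1 := n1_gt0.
rewrite /cnk sqr_sqrtr; last first.
  by rewrite divr_ge0 ?mulr_ge0 // ltW.
rewrite -mulnn !natrM natrB; last exact: ltnW.
move: n0 n1; move: (n%:R) (k%:R) => x y n0 n1.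
by field; rewrite n0 gt_eqF.
Qed.

Lemma ratio_gt0 : 0 < a.
Proof. by rewrite divr_gt0 // ltr0n // (leq_trans _ n_gt1). Qed.

Lemma ratio_lt1 : a < 1.
Proof. by rewrite ltr_pdivrMr ?ltr0n ?(leq_trans _ n_gt1) // mul1r ltr_nat. Qed.

Lemma cnk_gt0 : 0 < c.
Proof.
rewrite lt_def sqrtr_ge0 andbT; apply/eqP => c0.
have := cnk_sqr; rewrite c0 expr0n mul0r => /esym/eqP.
by rewrite mulf_eq0 !gt_eqF ?ratio_gt0 // subr_gt0 ratio_lt1.
Qed.

Lemma cnkC_neq0 : c%:C != 0 :> R[i].
Proof. by rewrite -[0]/(0%:C) (inj_eq (@complexI R)) gt_eqF ?cnk_gt0. Qed.

Lemma gram_seidel i j : G i j = a%:C * (i == j)%:R + c%:C * Q i j.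
Proof.
have c0 := cnkC_neq0.
rewrite /seidel -/(gram f) [in RHS]mxE mulrA divff // mul1r !mxE.
have -> : k%:R / n%:R = a%:C :> R[i] by rewrite rmorphM fmorphV !rmorph_nat.
by rewrite mulr_natr addrCA subrr addr0.
Qed.

Lemma seidel_conj i j : conjc (Q i j) = Q j i.
Proof.
have c0 := cnkC_neq0; apply: (mulfI c0); apply: (addrI (a%:C * (j == i)%:R)).
rewrite -gram_seidel -(gram_conj f i j) gram_seidel rmorphD !rmorphM /= oppr0.
by rewrite conjc_nat (eq_sym i).
Qed.

(** This is [G^2 = G] with [G = a I + c Q] substituted, solved for [Q^2]. *)
Lemma seidel_sqr i j :
  \sum_l Q i l * Q l j = (n%:R - 1) * (i == j)%:R + ((1 - 2 * a) / c)%:C * Q i j.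
Proof.
have c0 := cnkC_neq0.
have delta (x : 'I_n) (F : 'I_n -> R[i]) : \sum_l F l * (l == x)%:R = F x.
  rewrite (bigD1 x) //= eqxx mulr1 big1 ?addr0 // => l /negPf ->; exact: mulr0.
have /matrixP/(_ i j) := gram_idem f_parseval; rewrite mxE.
have E l : G i l * G l j = (a%:C * a%:C * (l == j)%:R) * (l == i)%:R
   + a%:C * c%:C * Q l j * (l == i)%:R + a%:C * c%:C * Q i l * (l == j)%:R
   + c%:C ^+ 2 * (Q i l * Q l j).
  by rewrite !gram_seidel (eq_sym i); ring.
under eq_bigr do rewrite E.
rewrite !big_split /= !delta -mulr_sumr gram_seidel => H.
have cs : c%:C ^+ 2 * (n%:R - 1) = a%:C * (1 - a%:C).
  have := congr1 (fun x : R => x%:C) cnk_sqr.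
  by rewrite /= !(rmorphM, rmorphB, rmorphXn, rmorph1, rmorph_nat).
apply: (mulfI (expf_neq0 2 c0)).
have -> : c%:C ^+ 2 * \sum_l Q i l * Q l j =
   a%:C * (1 - a%:C) * (i == j)%:R + c%:C * (1 - 2 * a%:C) * Q i j.
  by apply: (addrI (a%:C * a%:C * (i == j)%:R + a%:C * c%:C * Q i j
     + a%:C * c%:C * Q i j)); rewrite H; ring.
have -> : ((1 - 2 * a) / c)%:C = (1 - 2 * a%:C) / c%:C :> R[i].
  by rewrite !(rmorphM, fmorphV, rmorphB, rmorph1, rmorph_nat).
by rewrite -cs; move: (a%:C) (c%:C) c0 => x z z0; field.
Qed.

Lemma gram_diag_norm i : G i i = (lam [set i])%:C.
Proof.
have le := comp_norm_ge_diag f_parseval k_gt0 (set11 i).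
have ge0 : 0 <= complex.Re (G i i).
  by rewrite mxE Re_sum sumr_ge0 // => j _; rewrite !mxE mul_conjc abs2_ge0.
have Greal : G i i = (complex.Re (G i i))%:C.
  have := gram_conj f i i; case: (G i i) => x y /= [/eqP].
  by rewrite eq_sym -addr_eq0 -mulr2n mulrn_eq0 /= => /eqP ->.
(* [comp_norm_eigen] requires a positive norm; otherwise [0 <= G i i <= lam [set i] <= 0] settles
   the claim. *)
have [l0|l0] := ltP 0 (lam [set i]); last first.
  rewrite Greal; congr (_%:C); apply/le_anti; rewrite le /=.
  exact: le_trans l0 ge0.
have [y [y0 yA yE]] := comp_norm_eigen f_parseval k_gt0 l0.
have yi0 : y i 0 != 0.
  apply: contra_neq y0 => yi; apply/colP => j; rewrite mxE.
  by have [->//|ji] := eqVneq j i; apply: yA; rewrite inE.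
have := yE i (set11 i); rewrite mxE (bigD1 i) //= big1 => [|j ji].
  by rewrite addr0 => /(mulIf yi0).
by rewrite yA ?inE // mulr0.
Qed.

(** An eigenvector supported on [B] is a test vector for the Rayleigh bound on [A]. The converse
    direction uses this to select a root of a cubic. *)
Lemma comp_norm_mono (A B : {set 'I_n}) : B \subset A -> 0 < lam B -> lam B <= lam A.
Proof.
move=> BA l0; have [y [y0 yB yE]] := comp_norm_eigen f_parseval k_gt0 l0.
have := @comp_norm_ge _ _ _ _ _ f_parseval k_gt0 A y.
have -> : (adjmx y *m G *m y) 0 0 = (lam B * sqnorm y)%:C.
  have -> : (lam B * sqnorm y)%:C = (lam B)%:C * (sqnorm y)%:C by exact: rmorphM.
  rewrite -adjmx_mul_self -mulmxA mxE [(adjmx y *m y) 0 0]mxE mulr_sumr.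
  apply: eq_bigr => i _; have [iB|iB] := boolP (i \in B).
    by rewrite yE // mulrCA.
  by rewrite mxE yB // conjc0 !mul0r mulr0.
rewrite ler_pM2r; last by rewrite lt_def sqnorm_eq0 y0 sqnorm_ge0.
by apply=> i iA; apply: yB; apply: contraNN iA; apply: (fintype.subsetP BA).
Qed.

Hypothesis gram_diag : forall i, G i i = a%:C.

Lemma comp_norm_ge_ratio (A : {set 'I_n}) i : i \in A -> a <= lam A.
Proof.
by move=> iA; have := comp_norm_ge_diag f_parseval k_gt0 iA; rewrite gram_diag.
Qed.

Lemma seidel_diag i : Q i i = 0.
Proof.
have := gram_seidel i i; rewrite gram_diag eqxx mulr1 => /esym/eqP.
rewrite -subr_eq0 addrAC subrr add0r mulf_eq0 (negPf cnkC_neq0) /=; exact/eqP.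
Qed.

(** Since [G = a I + c Q], an eigenvalue [lam] of a principal submatrix of [G] becomes
    [(lam - a) / c] for [Q]. *)
Lemma seidel_eigen (s : seq 'I_n) : uniq s -> (0 < size s)%N ->
  eigen_on Q s ((lam [set x in s] - a) / c)%:C.
Proof.
move=> us s0; set A := [set x in s].
have l0 : 0 < lam A.
  case: s s0 us @A => [//|x s'] _ _ A.
  by apply: lt_le_trans ratio_gt0 (@comp_norm_ge_ratio _ x _); rewrite inE mem_head.
have [y [y0 yA yE]] := comp_norm_eigen f_parseval k_gt0 l0.
exists (fun i => y i 0).
  have /existsP[i yi] : [exists i, y i 0 != 0].
    apply: contraNT y0 => /existsPn H; apply/eqP/colP => i; rewrite mxE.
    by have := H i; rewrite negbK => /eqP.
  by exists i => //; apply: contraNT yi => iA; rewrite yA // inE.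
move=> i iS; have iA : i \in A by rewrite inE.
have := yE i iA; rewrite mxE.
have -> : \sum_j G i j * y j 0 = a%:C * y i 0 + c%:C * \sum_j Q i j * y j 0.
  rewrite mulr_sumr [X in _ = X + _](_ : _ = \sum_j a%:C * (i == j)%:R * y j 0).
    by rewrite -big_split /=; apply: eq_bigr => j _; rewrite gram_seidel; ring.
  rewrite (bigD1 i) //= eqxx mulr1 big1 ?addr0 // => j.
  by rewrite eq_sym => /negPf ->; rewrite mulr0 mul0r.
have -> : \sum_j Q i j * y j 0 = \sum_(j <- s) Q i j * y j 0.
  rewrite [RHS]big_uniq // [RHS]big_mkcond /=; apply: eq_bigr => j _.
  by case: ifPn => // js; rewrite yA ?mulr0 // inE.
move=> H; have c0 := cnkC_neq0; apply: (mulfI c0).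
apply: (addrI (a%:C * y i 0)); rewrite H.
have -> : ((lam A - a) / c)%:C = ((lam A)%:C - a%:C) / c%:C :> R[i].
  by rewrite !(rmorphM, fmorphV, rmorphB).
by move: (a%:C) (c%:C) c0 => x z z0; field.
Qed.

End SeidelMatrix.

(** * The two implications for a non-trivial frame *)

Section MainDirections.
Local Open Scope complex_scope.
Variables (R : realType) (realF : bool) (n k : nat) (f : 'I_n -> 'cV[R[i]]_k).
Hypothesis f_parseval : parseval_frame realF f.
Hypothesis k_gt1 : (1 < k)%N.
Hypothesis k_lt : (k.+1 < n)%N.
Local Notation G := (gram f).
Local Notation Q := (seidel f).
Local Notation a := (k%:R / n%:R : R).
Local Notation c := (cnk R n k).
Local Notation lam := (comp_norm realF f).

Let k_gt0 : (0 < k)%N. Proof. exact: ltnW. Qed.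
Let k_ltn : (k < n)%N. Proof. exact: ltnW. Qed.
Let n_gt3 : (3 < n)%N. Proof. exact: leq_ltn_trans k_lt. Qed.
Let n_gt1 : (1 < n)%N. Proof. exact: ltn_trans n_gt3. Qed.

(** Multiplied by [n^2 (n - 1)], the difference of the two sides is [n^2 (k - 1) (n - k - 1)], which
    vanishes only for trivial frames. *)
Lemma nontrivial_ratio : (n%:R - 2) ^+ 2 * c ^+ 2 != (1 - 2 * a) ^+ 2.
Proof.
apply/eqP => H; have n0 := n_neq0 R n_gt1; have n1 := n1_gt0 R n_gt1.
have cs := cnk_sqr R k_ltn n_gt1.
have K1 : 1 < k%:R :> R by rewrite ltr1n.
have N1 : k%:R + 1 < n%:R :> R by rewrite natr1 ltr_nat.
have : (n%:R - 2) ^+ 2 * (a * (1 - a)) = (1 - 2 * a) ^+ 2 * (n%:R - 1).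
  by rewrite -cs -H; ring.
move: n0 n1 K1 N1; move: (n%:R) (k%:R) => x y n0 n1 K1 N1.
move/(congr1 ( *%R^~ (x ^+ 2))).
have -> : (x - 2) ^+ 2 * (y / x * (1 - y / x)) * x ^+ 2 = (x - 2) ^+ 2 * (y * (x - y)).
  by field.
have -> : (1 - 2 * (y / x)) ^+ 2 * (x - 1) * x ^+ 2 = (x - 2 * y) ^+ 2 * (x - 1).
  by field.
move=> E; have : x ^+ 2 * ((y - 1) * (x - y - 1)) = 0.
  apply/eqP; rewrite -(subrr ((x - 2) ^+ 2 * (y * (x - y)))) {2}E.
  by apply/eqP; ring.
move/eqP; rewrite mulf_eq0 sqrf_eq0 (negPf n0) mulf_eq0 /=.
by move=> /orP[] /eqP; lra.
Qed.

Section Forward.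
Hypothesis f_uniform : uniform_c realF f 4.

Lemma uniform_comp_norm l : (1 <= l <= 4)%N ->
  exists v, forall s : seq 'I_n, uniq s -> size s = l -> lam [set x in s] = v.
Proof.
(* The first [l] indices serve as the reference set; they exist because [l <= 4 <= n]. *)
move=> hl; pose s0 := take l (enum 'I_n).
have us0 : uniq s0 by rewrite take_uniq ?enum_uniq.
have cs (s : seq 'I_n) : uniq s -> #|[set x in s]| = size s.
  by move=> us; rewrite cardsE; apply/card_uniqP.
exists (lam [set x in s0]) => s us sl; apply: (f_uniform hl); rewrite cs //.
rewrite size_takel // size_enum_ord; case/andP: hl => _ hl.
exact: leq_trans hl n_gt3.
Qed.

(** The diagonal is constant by 1-uniformity, and the trace [k] fixes its value. *)
Lemma uniform_gram_diag i : G i i = a%:C.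
Proof.
have [v vE] := uniform_comp_norm (isT : (1 <= 1 <= 4)%N).
have GE j : G j j = v%:C.
  have jE : [set j] = [set x in [:: j]] by apply/setP => x; rewrite !inE.
  by rewrite (gram_diag_norm f_parseval k_gt0) jE (vE [:: j]).
have := gram_trace f_parseval; rewrite /mxtrace.
under eq_bigr do rewrite GE.
rewrite sumr_const card_ord => H; rewrite GE.
have n0 := n_neq0 R n_gt1; congr (_%:C); apply: (mulIf n0); rewrite divfK //.
by apply: (@complexI R); rewrite rmorphM !rmorph_nat mulr_natr H.
Qed.

Let Q0 := seidel_diag k_gt0 k_ltn n_gt1 uniform_gram_diag.
Let Qc := seidel_conj f k_gt0 k_ltn n_gt1.

Lemma uniform_eigen l : (1 <= l <= 4)%N ->
  exists v : R, forall s : seq 'I_n, uniq s -> size s = l -> eigen_on Q s v%:C.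
Proof.
move=> hl; have [v vE] := uniform_comp_norm hl; exists ((v - a) / c) => s us sl.
rewrite -(vE s us sl); apply: seidel_eigen => //; first exact: uniform_gram_diag.
by rewrite sl; case/andP: hl.
Qed.

(** By 2-uniformity all these products equal one [v ^+ 2]; the diagonal of [Q^2] adds up [n - 1] of
    them to [n - 1]. *)
Lemma uniform_unimodular i j : i != j -> Q i j * Q j i = 1.
Proof.
have [v vE] := uniform_eigen (isT : (1 <= 2 <= 4)%N).
have QE x y : x != y -> Q x y * Q y x = v%:C ^+ 2.
  move=> xy; symmetry; apply: (eigen_on2 Q0); apply: vE => //=.
  by rewrite inE xy.
move=> ij; rewrite QE //.
have := seidel_sqr f_parseval k_gt0 k_ltn n_gt1 i i; rewrite Q0 eqxx mulr1 mulr0 addr0.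
rewrite (bigD1 i) //= Q0 mul0r add0r.
rewrite (eq_bigr (fun=> v%:C ^+ 2)); last by move=> l li; rewrite QE // eq_sym.
rewrite sumr_const cardC1 card_ord => H.
have nE : n.-1%:R = n%:R - 1 :> R[i] by rewrite -subn1 natrB // ltnW.
have n1 : n%:R - 1 != 0 :> R[i].
  by rewrite -nE pnatr_eq0 -lt0n -ltnS prednK // ltnW.
by apply: (mulfI n1); rewrite -{1}nE mulr_natl H mulr1.
Qed.

Let Q1 := uniform_unimodular.
Local Notation E a b c := (complex.Im (triple Q a b c)).

Lemma uniform_Re_triple : exists t : R, forall i j l, uniq [:: i; j; l] ->
  complex.Re (triple Q i j l) = t.
Proof.
have [v vE] := uniform_eigen (isT : (1 <= 3 <= 4)%N).
exists ((v ^+ 3 - 3 * v) / 2) => i j l u.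
have := eigen_on3 Q0 Q1 u (vE _ u erefl).
rewrite -/(triple Q i j l) -/(triple Q i l j) -(triple_conj Qc i j l).
rewrite addcJ; move: (complex.Re _) => x H.
have {}H : v ^+ 3 - 3 * v - 2 * x = 0.
  apply: (@complexI R); rewrite -[RHS]H.
  by rewrite !(rmorphB, rmorphM, rmorphXn, rmorph_nat).
by lra.
Qed.

Lemma uniform_Im_triple t : (forall i j l, uniq [:: i; j; l] ->
    complex.Re (triple Q i j l) = t) ->
  exists s : R, forall i j l m, uniq [:: i; j; l; m] ->
    E i j l * E i l m + E i l m * E i m j + E i m j * E i j l = s.
Proof.
move=> tE; have [v vE] := uniform_eigen (isT : (1 <= 4 <= 4)%N).
(* The quartic of [eigen_on4] with 3-cycle part [8 * t] and 4-cycle part [2 * (3 * t ^+ 2 - s)],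
   solved for [s]. *)
exists (- (v ^+ 4 - 6 * v ^+ 2 - 8 * t * v + 3 - 6 * t ^+ 2) / 2) => i j l m u.
have := eigen_on4 Q0 Q1 u (vE _ u erefl).
have [ul uj] := uniq4_fix_rot u; have [um ulm] := uniq4_fix_rot ul.
have [_ umj] := uniq4_fix_rot um.
have ujlm : uniq [:: j; l; m] by move: u => /= /andP[].
have -> : three_cycles Q i j l m = (8 * t)%:C.
  have tc x y z : uniq [:: x; y; z] ->
      Q x y * Q y z * Q z x + Q x z * Q z y * Q y x = (2 * t)%:C.
    move=> us; rewrite -/(triple Q x y z) -/(triple Q x z y) -(triple_conj Qc x y z).
    by rewrite -(tE _ _ _ us) addcJ rmorphM rmorph_nat.
  rewrite /three_cycles !tc //.
  by rewrite -!rmorphD; congr (_%:C); ring.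
(* A 4-cycle is cut along a diagonal into two triangles. *)
have X x y z w : x != z -> Q x y * Q y z * Q z w * Q w x = triple Q x y z * triple Q x z w.
  move=> xz; have -> : triple Q x y z * triple Q x z w =
     Q x y * Q y z * Q z w * Q w x * (Q x z * Q z x) by rewrite /triple; ring.
  by rewrite Q1 // mulr1.
have [ij il im] : [/\ i != j, i != l & i != m].
  by move: u; rewrite /= !inE !negb_or => /andP[/and3P[]].
have -> : four_cycles Q i j l m =
  (2 * complex.Re (triple Q i j l * triple Q i l m + triple Q i l m * triple Q i m j
     + triple Q i m j * triple Q i j l))%:C.
  rewrite rmorphM rmorph_nat -addcJ /four_cycles !X // !rmorphD !rmorphM /= !Qc.
  by rewrite /triple; ring.
move: (tE _ _ _ uj) (tE _ _ _ ulm) (tE _ _ _ umj).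
case: (triple Q i j l) (triple Q i l m) (triple Q i m j) => [x x'] [y y'] [z z'] /=.
move=> -> -> -> H.
have {}H : (v ^+ 4 - 6 * v ^+ 2 - v * (8 * t) + 3 -
   2 * (t * t - x' * y' + (t * t - y' * z') + (t * t - z' * x'))) = 0.
  apply: (@complexI R); rewrite -[RHS]H.
  by rewrite !(rmorphB, rmorphD, rmorphM, rmorphXn, rmorph_nat).
by lra.
Qed.

Lemma uniform_switching : switching_equiv4 Q (S4 R).
Proof.
have [t tE] := uniform_Re_triple; have [s sE] := uniform_Im_triple tE.
have Qsq x y : x != y -> \sum_l Q x l * Q l y = ((1 - 2 * a) / c)%:C * Q x y.
  by move=> xy; rewrite (seidel_sqr f_parseval k_gt0 k_ltn n_gt1) (negPf xy) mulr0 add0r.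
have c0 := cnk_gt0 R k_gt0 k_ltn n_gt1.
(* The real part of the sum of [triple Q x y l] over [l] gives [(n - 2) t = (1 - 2 a) / c], so
   [t^2 = 1] would contradict [nontrivial_ratio]. *)
have t1 : t ^+ 2 != 1.
  apply/eqP => t1; have /eqP := nontrivial_ratio; apply.
  have : (n%:R - 2) * t = (1 - 2 * a) / c.
    pose x := Ordinal (ltnW n_gt1); pose y := Ordinal n_gt1.
    have xy : x != y by [].
    have : \sum_l triple Q x y l = ((1 - 2 * a) / c)%:C.
      rewrite -[RHS]mulr1 -(Q1 xy) [RHS]mulrCA -Qsq 1?eq_sym // mulr_sumr.
      by apply: eq_bigr => l _; rewrite /triple mulrA.
    move/(congr1 (@complex.Re R)); rewrite Re_sum => /= <-.
    rewrite (bigD1 x) //= (bigD1 y) //=.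
    rewrite (eq_bigr (fun=> t)); last first.
      move=> l /andP[lx ly]; apply: tE.
      by rewrite /= !inE !negb_or xy (eq_sym x) lx (eq_sym y) ly.
    rewrite /triple !Q0 !(mulr0, mul0r) /= !add0r sumr_const -[RHS]mulr_natl; congr (_ * _).
    rewrite (_ : #|_| = n - 2)%N ?natrB //.
    have <- : #|~: [set x; y]| = (n - 2)%N.
      by rewrite cardsCs finset.setCK card_ord cards2 xy.
    by apply: eq_card => l; rewrite !inE negb_or.
  move/(congr1 (fun z => (z * c) ^+ 2)); rewrite divfK ?gt_eqF // => <-.
  by rewrite !exprMn t1 mulr1.
have [n4 t0] := four_points Q0 Qc Q1 tE sE Qsq t1 n_gt3.
have cyc := triangle_cyclic Q0 Qc Q1 tE sE Qsq t1 n_gt3.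
(* The matrix is generalized away from the frame so that [n] can be replaced by 4 in its type. *)
move: Q Q0 Qc Q1 tE cyc; rewrite t0 n4 => S S0 Sc S1 St Scyc.
exact: switching_S4_of_triples.
Qed.

End Forward.

(** The top eigenvalue of a principal submatrix of [Q] depends only on its size: it is 0, 1 and
    [Num.sqrt 3] for sizes 1, 2 and 3, and only one set has size 4. *)
Lemma switching_uniform : switching_equiv4 Q (S4 R) -> uniform_c realF f 4.
Proof.
move=> /switching_S4_props[n4 Q0 Q1 Qt].
have Gd i : G i i = a%:C by rewrite gram_seidel // eqxx mulr1 Q0 mulr0 addr0.
have c0 := cnk_gt0 R k_gt0 k_ltn n_gt1.
pose nu A : R := (lam A - a) / c.
have nuE A : lam A = a + c * nu A.
  by rewrite /nu [c * _]mulrC divfK ?gt_eqF // addrC subrK.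
have eig (A : {set 'I_n}) : (0 < #|A|)%N -> eigen_on Q (enum A) (nu A)%:C.
  move=> A0; have := seidel_eigen f_parseval k_gt0 k_ltn n_gt1 Gd (enum_uniq A).
  rewrite -cardE => /(_ A0); rewrite (_ : [set x in enum A] = A) //.
  by apply/setP => x; rewrite inE mem_enum.
have nu_ge0 (A : {set 'I_n}) : (0 < #|A|)%N -> 0 <= nu A.
  case/card_gt0P=> x xA; apply: divr_ge0 (ltW c0); rewrite subr_ge0.
  exact: (comp_norm_ge_ratio f_parseval k_gt0 Gd xA).
have nu1 (A : {set 'I_n}) : #|A| = 1%N -> lam A = a.
  move/eqP/cards1P => [x ->]; apply: (@complexI R).
  by rewrite -(Gd x) (gram_diag_norm f_parseval k_gt0).
have nu2 (A : {set 'I_n}) : #|A| = 2%N -> nu A = 1.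
  move=> A2; have A0 : (0 < #|A|)%N by rewrite A2.
  have := eig A A0; have := enum_uniq A; move: A2; rewrite cardE.
  case: (enum A) => [|x [|y [|]]] //= _; rewrite inE andbT => xy /(eigen_on2 Q0).
  rewrite Q1 // -rmorphXn => -[/eqP]; rewrite sqrp_eq1 ?nu_ge0 //.
  by move/eqP.
have nu3 (A : {set 'I_n}) : #|A| = 3%N -> nu A = Num.sqrt 3.
  move=> A3; have A0 : (0 < #|A|)%N by rewrite A3.
  (* The cubic is [v (v^2 - 3)]; comparison with a two-element subset rules out the roots 0 and
     [- Num.sqrt 3]. *)
  have nuA1 : 1 <= nu A.
    have [x xA] := card_gt0P A0.
    have c2 : #|A :\ x| = 2%N by have := cardsD1 x A; rewrite xA A3 => -[].
    have lB : 0 < lam (A :\ x).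
      by rewrite nuE nu2 // mulr1 addr_gt0 // ratio_gt0.
    have := comp_norm_mono f_parseval k_gt0 (finset.subsetDl A [set x]) lB.
    by rewrite !nuE nu2 // lerD2l ler_pM2l.
  have := eig A A0; have := enum_uniq A; move: A3; rewrite cardE.
  case: (enum A) => [|x [|y [|z [|]]]] // _ u /(eigen_on3 Q0 Q1 u).
  rewrite -/(triple Q x y z) -/(triple Q x z y).
  rewrite -(triple_conj (seidel_conj f k_gt0 k_ltn n_gt1) x y z).
  rewrite addcJ Qt // mulr0 subr0.
  have -> : (nu A)%:C ^+ 3 - 3 * (nu A)%:C = (nu A * (nu A ^+ 2 - 3))%:C.
    rewrite !(rmorphB, rmorphM, rmorphXn, rmorph_nat); ring.
  case=> /eqP; rewrite mulf_eq0 gt_eqF ?(lt_le_trans ltr01) //= subr_eq0 => /eqP <-.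
  by rewrite sqrtr_sqr ger0_norm // (le_trans ler01).
move=> l l_range A B cA cB; change (lam A = lam B).
have /or4P l_eq : [|| l == 1, l == 2, l == 3 | l == 4]%N.
  by move: l_range {cA cB}; case: l => [|[|[|[|[|]]]]].
case: l_eq => /eqP e; rewrite e in cA cB.
- exact: etrans (nu1 _ cA) (esym (nu1 _ cB)).
- by rewrite (nuE A) (nuE B) (nu2 _ cA) (nu2 _ cB).
- by rewrite (nuE A) (nuE B) (nu3 _ cA) (nu3 _ cB).
- have full (C : {set 'I_n}) : #|C| = 4%N -> C = [set: 'I_n].
    by move=> cC; apply/eqP; rewrite eqEcard finset.subsetT cardsT card_ord cC n4.
  by rewrite (full _ cA) (full _ cB).
Qed.

End MainDirections.

Theorem theorem3p14 (R : realType) (realF : bool) (n k : nat)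
  (f : 'I_n -> 'cV[R[i]]_k) :
  parseval_frame realF f -> (0 < k < n)%N -> k <> 1%N -> k <> (n - 1)%N ->
  (uniform_c realF f 4 <-> switching_equiv4 (seidel f) (S4 R)).
Proof.
move=> fP /andP[k0 kn] k1 kn1.
have k_gt1 : (1 < k)%N by case: k k0 k1 {f fP kn kn1} => [|[|]].
have k_lt : (k.+1 < n)%N.
  rewrite ltn_neqAle kn andbT; apply/eqP => e; apply: kn1.
  by rewrite -e subn1.
split; first exact: (uniform_switching fP k_gt1 k_lt).
exact: (switching_uniform fP k_gt1 k_lt).
Qed.
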